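(* Let $\mathrm{Bc}:\Omega_{\mathrm U}\to\mathbb Z\left[\frac12,a_1,a_2,a_3\right]$ be the Buchstaber genus and, for $n\ge1$, let $\Theta_n$ be a smooth theta divisor of complex dimension $n$ on a general principally polarised abelian variety of dimension $n+1$. Then the values $\mathrm{Bc}(\Theta_n)$ belong to the ring $\mathbb Z[a_1,a_2,a_3]$ for all $n\geq 1$.
   Context: $\Omega_{\mathrm U}$ is the complex cobordism ring. The Buchstaber genus is the ring homomorphism classifying the formal group law over $\mathbb Z[\frac12,a_1,a_2,a_3]$ $$F_{\mathrm{Bc}}(u,v)=\left[\left(\frac{u\sqrt{Q(v)}-v\sqrt{Q(u)}}{u^2-v^2}\right)^2+a_3u^2v^2\right]^{-1/2}=u+v+\cdots,\qquad Q(t)=1-a_1t^2+a_2t^4-a_3t^6,$$ whose exponential $f_{\mathrm{Bc}}$ over $\mathbb Q[a_1,a_2,a_3]$ is the compositional inverse of $\int_0^uQ(t)^{-1/2}dt$. It is known (Buchstaber–Veselov) that the exponential of the universal formal group law of complex cobordism is $f_{\mathrm U}(u)=u+\sum_{n\ge1}[\Theta_n]\frac{u^{n+1}}{(n+1)!}$, so that $f_{\mathrm{Bc}}(u)=u+\sum_{n\ge1}\mathrm{Bc}(\Theta_n)\frac{u^{n+1}}{(n+1)!}$. *)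

(* Defs.v *)
From HB Require Import structures.
From mathcomp Require Import all_boot all_order all_algebra.
From mathcomp Require Import boolp.
From mathcomp Require Import mpoly fraction.

Set Implicit Arguments.
Unset Strict Implicit.
Unset Printing Implicit Defensive.

Import Order.TTheory GRing.Theory Num.Theory.
Local Open Scope ring_scope.

Reserved Notation "{ 'mfps' R [ n ] }"
  (at level 0, R at level 2, format "{ 'mfps'  R [ n ] }").

Section ClassicalUnit.
Variable R : comNzRingType.

Definition classical_unit : {pred R} := fun x => `[< exists y, y * x = 1 >].

Definition classical_inv (x : R) : R :=
  if pselect (exists y, y * x = 1) is left ex then projT1 (cid ex) else x.

Lemma classical_mulVx : {in classical_unit, left_inverse 1 classical_inv *%R}.
Proof.
move=> x /asboolP Ux; rewrite /classical_inv.
by case: pselect => // ex; case: (cid ex).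
Qed.

Lemma classical_unitPl (x y : R) : y * x = 1 -> classical_unit x.
Proof. by move=> yx; apply/asboolP; exists y. Qed.

Lemma classical_inv_out : {in [predC classical_unit], classical_inv =1 id}.
Proof.
move=> x /negP Ux; rewrite /classical_inv.
by case: pselect => // ex; case: Ux; apply/asboolP.
Qed.

End ClassicalUnit.

Definition zhalf_pred : {pred rat} :=
  fun x => `[< exists k : nat, 2 ^+ k * x \is a Num.int >].

Lemma zhalf_subring : subring_closed zhalf_pred.
Proof.
split.
- by apply/asboolP; exists 0%N; rewrite mulr1 expr0 rpred1.
- move=> x y /asboolP[k kx] /asboolP[l ly]; apply/asboolP; exists (k + l)%N.
  rewrite exprD mulrBr rpredB //.
    by rewrite mulrAC rpredM // rpredX // rpred_nat.
  by rewrite -mulrA rpredM // rpredX // rpred_nat.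
- move=> x y /asboolP[k kx] /asboolP[l ly]; apply/asboolP; exists (k + l)%N.
  by rewrite exprD mulrACA rpredM.
Qed.

HB.instance Definition _ := GRing.isSubringClosed.Build rat zhalf_pred
  zhalf_subring.

Record Zhalf := MkZhalf { zhalf_val :> rat; _ : zhalf_val \in zhalf_pred }.

HB.instance Definition _ := [isSub for zhalf_val].
HB.instance Definition _ := [Choice of Zhalf by <:].
HB.instance Definition _ := [SubChoice_isSubComNzRing of Zhalf by <:].
HB.instance Definition _ := GRing.ComNzRing_hasMulInverse.Build Zhalf
  (@classical_mulVx Zhalf) (@classical_unitPl Zhalf)
  (@classical_inv_out Zhalf).

Lemma zhalf_integral : GRing.integral_domain_axiom Zhalf.
Proof.
move=> x y xy0; have /eqP := congr1 val xy0.
by rewrite rmorphM rmorph0 /= mulf_eq0.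
Qed.

HB.instance Definition _ := GRing.ComUnitRing_isIntegral.Build Zhalf
  zhalf_integral.

Record mfps (R : Type) (n : nat) := MFPS { mfps_coef :> 'X_{1..n} -> R }.

Notation "{ 'mfps' R [ n ] }" := (mfps R n) : type_scope.

HB.instance Definition _ R n := gen_eqMixin {mfps R[n]}.
HB.instance Definition _ R n := gen_choiceMixin {mfps R[n]}.

Lemma mfpsP R n (f g : {mfps R[n]}) : f =1 g -> f = g.
Proof. by case: f g => f [g] /= /funext ->. Qed.

Section MFPSZmod.
Variables (R : nzRingType) (n : nat).
Implicit Types f g h : {mfps R[n]}.

Definition mfps0 : {mfps R[n]} := MFPS (fun=> 0).
Definition mfps_opp f := MFPS (fun m => - f m).
Definition mfps_add f g := MFPS (fun m => f m + g m).

Lemma mfps_addA : associative mfps_add.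
Proof. by move=> f g h; apply: mfpsP => m /=; rewrite addrA. Qed.
Lemma mfps_addC : commutative mfps_add.
Proof. by move=> f g; apply: mfpsP => m /=; rewrite addrC. Qed.
Lemma mfps_add0 : left_id mfps0 mfps_add.
Proof. by move=> f; apply: mfpsP => m /=; rewrite add0r. Qed.
Lemma mfps_addN : left_inverse mfps0 mfps_opp mfps_add.
Proof. by move=> f; apply: mfpsP => m /=; rewrite addNr. Qed.

HB.instance Definition _ := GRing.isZmodule.Build {mfps R[n]}
  mfps_addA mfps_addC mfps_add0 mfps_addN.

Definition mfps_of_mpoly (p : {mpoly R[n]}) : {mfps R[n]} :=
  MFPS (fun m => p@_m).

(* The part of total degree at most d. *)
Definition mfps_trunc (d : nat) f : {mpoly R[n]} :=
  \sum_(m : 'X_{1..n < d.+1}) f m *: 'X_[m].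

Lemma mcoeff_trunc d f m :
  (mfps_trunc d f)@_m = if (mdeg m <= d)%N then f m else 0.
Proof.
case: leqP => [le_md|lt_dm]; first exact: mcoeff_mpoly.
rewrite raddf_sum big1 //= => k _; rewrite mcoeffZ mcoeffX.
case: eqP => [E|_]; last by rewrite mulr0.
by move: (bmdeg k); rewrite E ltnS leqNgt lt_dm.
Qed.

End MFPSZmod.

Section MFPSRing.
Variables (R : comNzRingType) (n : nat).
Implicit Types f g h : {mfps R[n]}.

(* The coefficient of X^m in a product of series only involves the
   coefficients of degree at most mdeg m of the factors. *)
Definition mfps_mul f g : {mfps R[n]} :=
  MFPS (fun m => (mfps_trunc (mdeg m) f * mfps_trunc (mdeg m) g)@_m).

Lemma mcoeffM_eq0 (p q : {mpoly R[n]}) m :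
    (forall k l, m = (k + l)%MM -> p@_k = 0 \/ q@_l = 0) ->
  (p * q)@_m = 0.
Proof.
move=> pq0; rewrite mcoeffM big1 // => -[k l] /= /eqP E.
by case: (pq0 _ _ E) => ->; rewrite (mul0r, mulr0).
Qed.

Lemma mcoeffM_congr (p p' q q' : {mpoly R[n]}) m :
    (forall k, (mdeg k <= mdeg m)%N -> p@_k = p'@_k) ->
    (forall k, (mdeg k <= mdeg m)%N -> q@_k = q'@_k) ->
  (p * q)@_m = (p' * q')@_m.
Proof.
move=> pp' qq'; apply/eqP; rewrite -subr_eq0 -mcoeffB.
have -> : p * q - p' * q' = (p - p') * q + p' * (q - q').
  by rewrite mulrBl mulrBr addrA subrK.
rewrite mcoeffD mcoeffM_eq0 ?add0r => [|k l mE]; last first.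
  by left; rewrite mcoeffB pp' ?subrr // mE mdegD leq_addr.
rewrite mcoeffM_eq0 // => k l mE; right.
by rewrite mcoeffB qq' ?subrr // mE mdegD leq_addl.
Qed.

Lemma mfps_mulE d f g m : (mdeg m <= d)%N ->
  (mfps_mul f g) m = (mfps_trunc d f * mfps_trunc d g)@_m.
Proof.
move=> le_md /=; apply: mcoeffM_congr => k le_km;
by rewrite !mcoeff_trunc le_km (leq_trans le_km).
Qed.

Lemma mfps_mulA : associative mfps_mul.
Proof.
move=> f g h; apply: mfpsP => m.
rewrite [LHS](mfps_mulE (d := mdeg m)) // [RHS](mfps_mulE (d := mdeg m)) //.
transitivity (mfps_trunc (mdeg m) f * (mfps_trunc (mdeg m) g *
              mfps_trunc (mdeg m) h))@_m.
  apply: mcoeffM_congr => // k le_km.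
  by rewrite mcoeff_trunc le_km (mfps_mulE (d := mdeg m)).
rewrite mulrA; apply: mcoeffM_congr => // k le_km.
by rewrite mcoeff_trunc le_km (mfps_mulE (d := mdeg m)).
Qed.

Lemma mfps_mulC : commutative mfps_mul.
Proof. by move=> f g; apply: mfpsP => m /=; rewrite mulrC. Qed.

Lemma mfps_mul1 : left_id (mfps_of_mpoly 1) mfps_mul.
Proof.
move=> f; apply: mfpsP => m /=.
rewrite (@mcoeffM_congr _ 1 _ (mfps_trunc (mdeg m) f)) //.
  by rewrite mul1r mcoeff_trunc leqnn.
by move=> k le_km; rewrite mcoeff_trunc le_km.
Qed.

Lemma mfps_mulDl : left_distributive mfps_mul +%R.
Proof.
move=> f g h; apply: mfpsP => m /=; rewrite -mcoeffD -mulrDl.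
by apply: mcoeffM_congr => // k le_km; rewrite mcoeffD !mcoeff_trunc le_km.
Qed.

Lemma mfps_1_neq0 : mfps_of_mpoly 1 != 0 :> {mfps R[n]}.
Proof.
apply/eqP => /(congr1 (fun f : {mfps R[n]} => f 0%MM)) /= /eqP.
by rewrite mcoeff1 eqxx oner_eq0.
Qed.

HB.instance Definition _ := GRing.Zmodule_isComNzRing.Build {mfps R[n]}
  mfps_mulA mfps_mulC mfps_mul1 mfps_mulDl mfps_1_neq0.

HB.instance Definition _ := GRing.ComNzRing_hasMulInverse.Build {mfps R[n]}
  (@classical_mulVx {mfps R[n]}) (@classical_unitPl {mfps R[n]})
  (@classical_inv_out {mfps R[n]}).

End MFPSRing.

Section MFPSDomain.
Variables (R : idomainType) (n : nat).
Implicit Types f g h : {mfps R[n]}.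

Lemma mfps_low_part f : f != 0 ->
  exists d, (mfps_trunc d f != 0) /\ (forall m, (mdeg m < d)%N -> f m = 0).
Proof.
move=> f0; have exd : exists d, `[< exists2 m, mdeg m = d & f m != 0 >].
  apply: contrapT => nex; case/eqP: f0; apply: mfpsP => m /=.
  apply: contrapT => /eqP fm; apply: nex; exists (mdeg m).
  by apply/asboolP; exists m.
case: (ex_minnP exd) => d /asboolP[m md fm] dmin; exists d; split.
  apply/eqP => /(congr1 (mcoeff m)) /eqP.
  by rewrite mcoeff_trunc md leqnn mcoeff0 (negPf fm).
move=> k lt_kd; apply/eqP; apply: contraTT lt_kd => fk.
by rewrite -leqNgt; apply/dmin/asboolP; exists k.
Qed.

Lemma mfps_integral : GRing.integral_domain_axiom {mfps R[n]}.
Proof.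
move=> f g fg0; apply: contraT; rewrite negb_or.
case/andP => /mfps_low_part[d [pn0 f0]] /mfps_low_part[e [qn0 g0]].
have pq_n0 : mfps_trunc d f * mfps_trunc e g != 0 by rewrite mulf_neq0.
case/negP: pq_n0; apply/eqP/mpolyP => m; rewrite mcoeff0.
have [md|md] := eqVneq (mdeg m) (d + e)%N; last first.
  apply: mcoeffM_eq0 => k l mE; rewrite !mcoeff_trunc.
  case: (ltngtP (mdeg k) d) => [/f0 ->|//|kd]; [by left|by left|].
  case: (ltngtP (mdeg l) e) => [/g0 ->|//|le]; [by right|by right|].
  by case/eqP: md; rewrite mE mdegD kd le.
transitivity ((f * g) m); last by rewrite fg0.
rewrite (@mfps_mulE _ _ (d + e)%N) ?md //.
apply/eqP; rewrite -subr_eq0 -mcoeffB.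
set p := mfps_trunc d f; set q := mfps_trunc e g.
set p' := mfps_trunc _ f; set q' := mfps_trunc _ g.
have -> : p * q - p' * q' = (p - p') * q + p' * (q - q').
  by rewrite mulrBl mulrBr addrA subrK.
rewrite mcoeffD mcoeffM_eq0 ?add0r => [|k l mE]; last first.
  rewrite mcoeffB !mcoeff_trunc; have [ld|ld] := ltnP (mdeg l) e.
    by right; rewrite g0 // if_same.
  left; have kd' : (mdeg k <= d)%N.
    by rewrite -(leq_add2r (mdeg l)) -mdegD -mE md leq_add2l.
  by rewrite kd' (leq_trans kd' (leq_addr _ _)) subrr.
rewrite mcoeffM_eq0 // => k l mE; rewrite mcoeffB !mcoeff_trunc.
have [kd|kd] := ltnP (mdeg k) d; first by left; rewrite f0 // if_same.
right; have ld' : (mdeg l <= e)%N.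
  by rewrite -(leq_add2l (mdeg k)) -mdegD -mE md leq_add2r.
by rewrite ld' (leq_trans ld' (leq_addl _ _)) subrr.
Qed.

HB.instance Definition _ := GRing.ComUnitRing_isIntegral.Build {mfps R[n]}
  mfps_integral.

End MFPSDomain.

Definition mfpsC (R : nzRingType) (n : nat) (c : R) : {mfps R[n]} :=
  mfps_of_mpoly c%:MP.

Definition mfpsX (R : nzRingType) (n : nat) (i : 'I_n) : {mfps R[n]} :=
  mfps_of_mpoly 'X_i.

Definition mfps_map (R S : Type) (n : nat) (phi : R -> S)
  (f : {mfps R[n]}) : {mfps S[n]} := MFPS (fun m => phi (f m)).

(* Substitution f(g_0, ..., g_(n-1)).  It is the usual one only when every g_i
   has zero constant term: then its coefficient at X^m only involves the
   coefficients of degree at most mdeg m of f and of the g_i. *)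
Definition mfps_comp (R : nzRingType) (n k : nat) (f : {mfps R[n]})
    (g : n.-tuple {mfps R[k]}) : {mfps R[k]} :=
  MFPS (fun m =>
    (mfps_trunc (mdeg m) f \mPo map_tuple (mfps_trunc (mdeg m)) g)@_m).

Definition formal_group_law (R : nzRingType) (F : {mfps R[2]}) : Prop :=
  let t : {mfps R[1]} := mfpsX R ord0 in
  let u : {mfps R[2]} := mfpsX R (inord 0) in
  let v : {mfps R[2]} := mfpsX R (inord 1) in
  let x : {mfps R[3]} := mfpsX R (inord 0) in
  let y : {mfps R[3]} := mfpsX R (inord 1) in
  let z : {mfps R[3]} := mfpsX R (inord 2) in
  [/\ mfps_comp F [tuple t; 0] = t,
      mfps_comp F [tuple u; v] = mfps_comp F [tuple v; u]
    & mfps_comp F [tuple mfps_comp F [tuple x; y]; z] =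
      mfps_comp F [tuple x; mfps_comp F [tuple y; z]]].

(* By Quillen's theorem the pair (Omega_U, F_U) of the complex cobordism ring
   and its formal group law of geometric cobordisms is characterised, up to a
   unique isomorphism, by this universal property. *)
Definition universal_fgl (L : comNzRingType) (F : {mfps L[2]}) : Prop :=
  formal_group_law F /\
  forall (R : comNzRingType) (G : {mfps R[2]}), formal_group_law G ->
    exists phi : {rmorphism L -> R},
      mfps_map phi F = G /\
      forall psi : {rmorphism L -> R}, mfps_map psi F = G -> psi =1 phi.

Definition is_exponential (R : nzRingType) (F : {mfps R[2]})
    (f : {mfps R[1]}) : Prop :=
  let u : {mfps R[2]} := mfpsX R (inord 0) in
  let v : {mfps R[2]} := mfpsX R (inord 1) in
  [/\ f 0%MM = 0, f U_(ord0)%MM = 1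
    & mfps_comp F [tuple mfps_comp f [tuple u]; mfps_comp f [tuple v]] =
      mfps_comp f [tuple u + v]].

(* iota : L -> K exhibits K as L tensor Q, for L without additive torsion. *)
Definition is_rationalisation (L : comNzRingType) (K : comAlgType rat)
    (iota : {rmorphism L -> K}) : Prop :=
  injective iota /\
  forall x : K, exists (d : nat) (y : L), (0 < d)%N /\ x *+ d = iota y.

(* u + \sum_(n >= 1) Theta_n u^(n+1) / (n+1)!; Theta 0 is not used. *)
Definition theta_series (L : comNzRingType) (K : comAlgType rat)
    (iota : L -> K) (Theta : nat -> L) : {mfps K[1]} :=
  MFPS (fun m => match mdeg m with
                 | 0 => 0
                 | 1 => 1
                 | n.+1 => ((n.+1)`!%:R^-1 : rat) *: iota (Theta n)
                 end).

(* The classes of the smooth theta divisors in the complex cobordism ring, as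
   determined by the theorem of Buchstaber and Veselov: their generating series
   is the exponential of the universal formal group law. *)
Definition theta_divisor_classes (L : comNzRingType) (F : {mfps L[2]})
    (Theta : nat -> L) : Prop :=
  exists (K : comAlgType rat) (iota : {rmorphism L -> K}),
    is_rationalisation iota /\
    is_exponential (mfps_map iota F) (theta_series iota Theta).

Local Notation "x %:F" := (tofrac x) : ring_scope.

(* The bracket in the formula for F_Bc has a pole along u + v = 0, so that the
   formula is read in the fraction field of R[[u, v]]: F^(-2) is the bracket,
   and the sign of F is fixed by F = u + v + ... .  The series s is the square
   root of Q with constant term 1. *)
Definition is_buchstaber_fgl (R : idomainType) (a1 a2 a3 : R)
    (F : {mfps R[2]}) : Prop :=
  let t : {mfps R[1]} := mfpsX R ord0 in
  let u : {mfps R[2]} := mfpsX R (inord 0) in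
  let v : {mfps R[2]} := mfpsX R (inord 1) in
  let Q : {mfps R[1]} :=
    1 - mfpsC 1 a1 * t ^+ 2 + mfpsC 1 a2 * t ^+ 4 - mfpsC 1 a3 * t ^+ 6 in
  [/\ F 0%MM = 0, F U_(inord 0)%MM = 1, F U_(inord 1)%MM = 1
    & exists s : {mfps R[1]},
        [/\ s 0%MM = 1, s ^+ 2 = Q
          & F%:F ^- 2 =
              ((u * mfps_comp s [tuple v] - v * mfps_comp s [tuple u])%:F /
               (u ^+ 2 - v ^+ 2)%:F) ^+ 2
              + (mfpsC 2 a3 * u ^+ 2 * v ^+ 2)%:F]].

(* Z[1/2, a_1, a_2, a_3] is {mpoly Zhalf[3]}, with a_1, a_2, a_3 the variables
   of index 0, 1, 2. *)
Definition is_buchstaber_genus (L : comNzRingType) (F : {mfps L[2]})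
    (Bc : {rmorphism L -> {mpoly Zhalf[3]}}) : Prop :=
  is_buchstaber_fgl ('X_(inord 0) : {mpoly Zhalf[3]}) 'X_(inord 1) 'X_(inord 2)
    (mfps_map Bc F).

(* Main.v *)
From HB Require Import structures.
Require Import Defs.
From mathcomp Require Import all_boot all_order all_algebra.
From mathcomp Require Import mpoly.
From mathcomp Require Import boolp fraction ring.

Set Implicit Arguments.
Unset Strict Implicit.
Unset Printing Implicit Defensive.

Import GRing.Theory.
Local Open Scope ring_scope.

(** Write F(u, v) = u + F_1(u) v + O(v^2).  Modulo v^2 the defining formula of
the Buchstaber formal group law gives F_1 = sqrt(Q), and the coefficients of
u^n v in F(f(u), f(v)) = f(u + v) say that f' = F_1(f).  Hence f'^2 = Q(f), and
differentiating, f'' = Q'(f)/2 = - a_1 f + 2 a_2 f^3 - 3 a_3 f^5, in which the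
factor 1/2 has disappeared.  Since f(0) = 0, f'(0) = 1 and Hurwitz series over
Z[a_1, a_2, a_3] are closed under products, induction on n shows that the n-th
derivatives of f at 0, which are the numbers Bc(Theta_(n-1)), lie in
Z[a_1, a_2, a_3]. *)

(** * The differential equation of the exponential *)

Section PolyCongruence.
Variable R : comNzRingType.
Implicit Types (p q f g h : {poly R}) (N : nat).

Definition elliptic_poly (a1 a2 a3 : R) : {poly R} :=
  1 - a1 *: 'X^2 + a2 *: 'X^4 - a3 *: 'X^6.

(** Congruence modulo X^N with an explicit quotient, a form that can be composed and
    differentiated. *)
Lemma eq_coef_upto N f g :
  (forall n, (n < N)%N -> f`_n = g`_n) <-> exists r, f = g + r * 'X^N.
Proof.
split=> [fg | [r ->] n lt_nN]; last by rewrite coefD coefMXn lt_nN addr0.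
exists (drop_poly N (f - g)); rewrite -[LHS](subrK g) addrC; congr (_ + _).
rewrite -[LHS](poly_take_drop N) (_ : take_poly N _ = 0) ?add0r //.
apply/polyP => i; rewrite coef_take_poly coef0 coefB.
by case: ltnP => // /fg ->; rewrite subrr.
Qed.

(** A constant term 1 makes h invertible modulo X^N: the n-th coefficient of h g is g_n plus terms
    in earlier coefficients of g, already known to vanish. *)
Lemma mul_unit_coef_upto N h g : h`_0 = 1 ->
    (forall n, (n < N)%N -> (h * g)`_n = 0) ->
  forall n, (n < N)%N -> g`_n = 0.
Proof.
move=> h0 hg0; elim/ltn_ind => n IH lt_nN.
have := hg0 n lt_nN; rewrite coefM big_ord_recl subn0 h0 mul1r.
rewrite big1 ?addr0 // => i _; rewrite IH ?mulr0 //.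
  by rewrite lift0 ltn_subrL (leq_ltn_trans _ (ltn_ord i)).
by rewrite (leq_ltn_trans (leq_subr _ _)).
Qed.

(* Differentiate (p')^2 = Q(p) and cancel 2p'. *)
Lemma elliptic_ode (a1 a2 a3 : R) p q N :
    (forall x : R, x *+ 2 = 0 -> x = 0) -> p`_0 = 0 -> p`_1 = 1 ->
    (forall n, (n < N)%N -> p^`()`_n = (q \Po p)`_n) ->
    (forall n, (n < N)%N -> (q ^+ 2)`_n =
       (elliptic_poly a1 a2 a3)`_n) ->
  forall n, (n < N.-1)%N -> (p^`()^`())`_n =
    ((3 * a3) *: - p ^+ 5 + (2 * a2) *: p ^+ 3 - a1 *: p)`_n.
Proof.
case: N => // N tors p0 p1 /eq_coef_upto[r dp] /eq_coef_upto[t q2] n /= lt_nN.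
(* Since X divides p, substituting p into a multiple of X^(N+1) gives another such multiple. *)
have pX : p = drop_poly 1 p * 'X.
  rewrite -[LHS](poly_take_drop 1) expr1 (_ : take_poly 1 p = 0) ?add0r //.
  by apply/polyP => -[|i]; rewrite coef_take_poly coef0 ?p0.
have [w dp2] : exists w, p^`() ^+ 2 =
    1 - a1 *: p ^+ 2 + a2 *: p ^+ 4 - a3 *: p ^+ 6 + w * 'X^(N.+1).
  have /(congr1 (comp_poly p)) := q2.
  rewrite rmorphXn /= /elliptic_poly !(comp_polyB, comp_polyD) comp_polyM.
  rewrite !comp_polyZ comp_polyC.
  have compXn k : 'X^k \Po p = p ^+ k by rewrite rmorphXn /= comp_polyX.
  rewrite !compXn [in X in _ + _ * X]pX exprMn => E.
  (* The quotient collects the error of q^2 = Q evaluated at p, then the cross term and the square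
     produced by p' = q(p) + r X^(N+1). *)
  exists ((t \Po p) * drop_poly 1 p ^+ N.+1 + (q \Po p) * r *+ 2 +
          r ^+ 2 * 'X^(N.+1)).
  by rewrite dp sqrrD E; ring.
(* It suffices to treat twice the difference, multiplied by p', whose constant term is 1. *)
apply/eqP; rewrite -subr_eq0; apply/eqP; rewrite -coefB; apply: tors.
rewrite -coefMn; apply: (@mul_unit_coef_upto N p^`()) (lt_nN).
  by rewrite coef_deriv p1.
move=> k lt_kN; have := congr1 (fun f => f^`()) dp2.
rewrite -!mul_polyC !derivE /= => E.
(* Differentiating the error w X^(N+1) leaves only a multiple of X^N: one order of precision is
   lost. *)
have -> : p^`() * ((p^`()^`() -
    ((3 * a3)%:P * - p ^+ 5 + (2 * a2)%:P * p ^+ 3 - a1%:P * p)) *+ 2) =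
    (w^`() * 'X + w *+ N.+1) * 'X^N.
  rewrite !rmorphM !rmorph_nat /=.
  apply/eqP; rewrite -subr_eq0; move/eqP: E; rewrite -subr_eq0 => /eqP <-.
  by apply/eqP; rewrite (exprSr 'X N) mulrnAr -mulrnAl; ring.
by rewrite coefMXn lt_kN.
Qed.

(** * Hurwitz polynomials over a subring *)

Variable S : subringClosed R.

(** The derivatives of p at 0 of order below N lie in S. *)
Definition hurwitz_upto N p := forall k, (k < N)%N -> p`_k *+ k`! \in S.

Lemma hurwitz_uptoD N p q :
  hurwitz_upto N p -> hurwitz_upto N q -> hurwitz_upto N (p + q).
Proof. by move=> Hp Hq k kN; rewrite coefD mulrnDl rpredD ?Hp ?Hq. Qed.

Lemma hurwitz_uptoN N p : hurwitz_upto N p -> hurwitz_upto N (- p).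
Proof. by move=> Hp k kN; rewrite coefN mulNrn rpredN Hp. Qed.

Lemma hurwitz_uptoZ N a p :
  a \in S -> hurwitz_upto N p -> hurwitz_upto N (a *: p).
Proof. by move=> Sa Hp k kN; rewrite coefZ -mulrnAr rpredM ?Hp. Qed.

(** Leibniz rule: k! p_i q_(k-i) is a binomial coefficient times i! p_i times (k-i)! q_(k-i). *)
Lemma hurwitz_uptoM N p q :
  hurwitz_upto N p -> hurwitz_upto N q -> hurwitz_upto N (p * q).
Proof.
move=> Hp Hq k kN; rewrite coefM -sumrMnl rpred_sum // => -[i /=].
rewrite ltnS => le_ik _; rewrite -(bin_fact le_ik) mulnC mulrnA rpredMn //.
rewrite mulrnA -mulrnAl -mulrnAr rpredM // ?Hp ?Hq //.
  exact: leq_ltn_trans kN.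
exact: leq_ltn_trans (leq_subr _ _) kN.
Qed.

Lemma hurwitz_uptoX N p n : hurwitz_upto N p -> hurwitz_upto N (p ^+ n.+1).
Proof.
by move=> Hp; elim: n => // n IH; rewrite exprS; apply: hurwitz_uptoM.
Qed.

(** The equation expresses the derivative of order M+2 at 0 by that of order M of a polynomial in p
    over S, which involves only lower derivatives of p. Orders 0 and 1 are the initial values. *)
Lemma elliptic_hurwitz (a1 a2 a3 : R) p N : a1 \in S -> a2 \in S -> a3 \in S ->
    p`_0 = 0 -> p`_1 = 1 ->
    (forall n, (n < N)%N -> (p^`()^`())`_n =
      ((3 * a3) *: - p ^+ 5 + (2 * a2) *: p ^+ 3 - a1 *: p)`_n) ->
  hurwitz_upto N.+2 p.
Proof.
move=> Sa1 Sa2 Sa3 p0 p1 ode.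
suff H M : (M <= N.+2)%N -> hurwitz_upto M p by apply: H.
elim: M => [//|M IH] lt_MN k.
rewrite ltnS leq_eqVlt => /orP[/eqP{k}->|]; last first.
  by apply: IH; apply: ltnW.
case: M => [|[|M]] in IH lt_MN *; first by rewrite p0 mul0rn rpred0.
  by rewrite p1 rpredMn // rpred1.
have -> : p`_M.+2 *+ M.+2`! = (p^`()^`())`_M *+ M`!.
  by rewrite !coef_deriv -!mulrnA !factS; congr (_ *+ _); ring.
rewrite ode //.
have Hp := IH (ltnW lt_MN).
have : hurwitz_upto M.+2 ((3 * a3) *: - p ^+ 5 + (2 * a2) *: p ^+ 3 - a1 *: p).
  apply: hurwitz_uptoD; first apply: hurwitz_uptoD.
  - apply: hurwitz_uptoZ; [by rewrite rpredM ?rpred_nat |].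
    exact/hurwitz_uptoN/hurwitz_uptoX.
  - apply: hurwitz_uptoZ; [by rewrite rpredM ?rpred_nat |].
    exact/hurwitz_uptoX.
  - by apply/hurwitz_uptoN/hurwitz_uptoZ.
by apply.
Qed.

End PolyCongruence.

Lemma map_elliptic_poly (R S : comNzRingType) (phi : {rmorphism R -> S})
    a1 a2 a3 :
  map_poly phi (elliptic_poly a1 a2 a3) =
  elliptic_poly (phi a1) (phi a2) (phi a3).
Proof.
rewrite /elliptic_poly !(rmorphB, rmorphD) /= !map_polyZ /= !map_polyXn.
by rewrite rmorph1.
Qed.

(** * Coefficients of power series and of their compositions *)

Definition mon1 (i : nat) : 'X_{1..1} := (U_(ord0) *+ i)%MM.
Definition mon2 (i j : nat) : 'X_{1..2} :=
  (U_(inord 0) *+ i + U_(inord 1) *+ j)%MM.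

Lemma mdeg_mon1 i : mdeg (mon1 i) = i.
Proof. by rewrite mdegMn mdeg1 mul1n. Qed.

Lemma mdeg_mon2 i j : mdeg (mon2 i j) = (i + j)%N.
Proof. by rewrite mdegD !mdegMn !mdeg1 !mul1n. Qed.

Lemma mon1E (m : 'X_{1..1}) : m = mon1 (m ord0).
Proof. by apply/mnmP => i; rewrite mulmnE mnm1E (ord1 i) mul1n. Qed.

Lemma inord01 : (inord 0 == inord 1 :> 'I_2) = false.
Proof. by rewrite -val_eqE /= !inordK. Qed.

Lemma mon2_0 i j : mon2 i j (inord 0) = i.
Proof. by rewrite mnmDE !mulmnE !mnm1E eqxx eq_sym inord01 mul1n addn0. Qed.

Lemma mon2_1 i j : mon2 i j (inord 1) = j.
Proof. by rewrite mnmDE !mulmnE !mnm1E eqxx inord01 mul1n. Qed.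

Lemma ord2P (i : 'I_2) : i = inord 0 \/ i = inord 1.
Proof.
by case: i => -[|[|//]] lt_i; [left|right]; apply: val_inj; rewrite /= inordK.
Qed.

Lemma mon2E (m : 'X_{1..2}) : m = mon2 (m (inord 0)) (m (inord 1)).
Proof. by apply/mnmP => i; case: (ord2P i) => ->; rewrite (mon2_0, mon2_1). Qed.

Lemma eq_mon1 m i : (m == mon1 i) = (m ord0 == i).
Proof.
apply/eqP/eqP => [->|<-]; last exact: mon1E.
by rewrite mulmnE mnm1E mul1n.
Qed.

Lemma eq_mon2 m i j :
  (m == mon2 i j) = (m (inord 0) == i) && (m (inord 1) == j).
Proof.
apply/eqP/andP => [->|[/eqP<- /eqP<-]]; last exact: mon2E.
by rewrite mon2_0 mon2_1.
Qed.

Section Coefficients.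
Variable R : comNzRingType.

(** Here v is the outer variable and u the inner one, so that working modulo v^2 means looking at
    the outer coefficients 0 and 1. *)
Definition bipoly (p : {mpoly R[2]}) : {poly {poly R}} :=
  mmap (polyC \o polyC) (fun i : 'I_2 => if i == inord 0 then 'X%:P else 'X) p.

Lemma bipolyM p q : bipoly (p * q) = bipoly p * bipoly q.
Proof. exact: rmorphM. Qed.

Definition unipoly (p : {mpoly R[1]}) : {poly R} := mmap polyC (fun=> 'X) p.

Lemma bipolyXn p k : bipoly (p ^+ k) = bipoly p ^+ k.
Proof. exact: rmorphXn. Qed.

Lemma unipolyM p q : unipoly (p * q) = unipoly p * unipoly q.
Proof. exact: rmorphM. Qed.

Lemma coef_unipoly p i : (unipoly p)`_i = p@_(mon1 i).
Proof.
rewrite {2}(mpolyE p) /unipoly /mmap raddf_sum coef_sum /=.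
apply: eq_bigr => m _; rewrite coefCM mcoeffZ mcoeffX /mmap1 big_ord1 coefXn.
by rewrite eq_mon1 eq_sym.
Qed.

Lemma coef_bipoly p i j : (bipoly p)`_j`_i = p@_(mon2 i j).
Proof.
rewrite {2}(mpolyE p) /bipoly /mmap raddf_sum !coef_sum /=.
apply: eq_bigr => m _; rewrite coefCM mcoeffZ mcoeffX /mmap1.
rewrite (bigD1 (inord 0)) //= (bigD1 (inord 1)) /= 1?eq_sym ?inord01 //.
rewrite big1 => [|k]; last by case/andP; case: (ord2P k) => ->; rewrite eqxx.
rewrite eqxx mulr1 -polyC_exp !coefCM coefXn mulrC.
rewrite eq_mon2 (eq_sym _ i) (eq_sym _ j) mulrC; case: (j == _).
  by rewrite mulr1 coefXn andbT.
by rewrite mulr0 coef0 andbF.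
Qed.

Lemma mfps_mul1E (f g : {mfps R[1]}) i :
  (f * g) (mon1 i) = \sum_(a < i.+1) f (mon1 a) * g (mon1 (i - a)).
Proof.
rewrite /= mdeg_mon1 -coef_unipoly unipolyM coefM; apply: eq_bigr => a _.
rewrite !coef_unipoly !mcoeff_trunc !mdeg_mon1 leq_subr.
by rewrite -ltnS ltn_ord.
Qed.

Lemma mfps_mul2E (f g : {mfps R[2]}) i j :
  (f * g) (mon2 i j) = \sum_(b < j.+1) \sum_(a < i.+1)
     f (mon2 a b) * g (mon2 (i - a) (j - b)).
Proof.
rewrite /= mdeg_mon2 -coef_bipoly bipolyM coefM coef_sum; apply: eq_bigr => b _.
rewrite coefM; apply: eq_bigr => a _.
rewrite !coef_bipoly !mcoeff_trunc !mdeg_mon2.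
have la : (a <= i)%N by rewrite -ltnS ltn_ord.
have lb : (b <= j)%N by rewrite -ltnS ltn_ord.
by rewrite !leq_add ?leq_subr.
Qed.

Lemma trunc1E d (f : {mfps R[1]}) :
  mfps_trunc d f = \sum_(k < d.+1) f (mon1 k) *: 'X_ord0 ^+ k.
Proof.
apply/mpolyP => m; rewrite mcoeff_trunc raddf_sum /= [in LHS](mon1E m).
have E (k : 'I_d.+1) : (f (mon1 k) *: 'X_ord0 ^+ k)@_m =
    if m ord0 == k then f (mon1 k) else 0.
  rewrite mcoeffZ mpolyXn mcoeffX -/(mon1 k) eq_sym eq_mon1.
  by case: eqP; rewrite (mulr1, mulr0).
under eq_bigr do rewrite E; rewrite mdeg_mon1 -big_mkcond /=; case: leqP => md.
  rewrite (big_pred1 (inord (m ord0))) /= ?inordK // => k.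
  by apply/eqP/eqP => [->|->]; rewrite ?inord_val ?inordK.
by rewrite big_pred0 // => k; rewrite gtn_eqF // (leq_trans (ltn_ord k)).
Qed.

Lemma mfps_comp1E n (f : {mfps R[1]}) (g : {mfps R[n]}) m :
  mfps_comp f [tuple g] m =
  \sum_(k < (mdeg m).+1) f (mon1 k) * (mfps_trunc (mdeg m) g ^+ k)@_m.
Proof.
rewrite /= trunc1E (raddf_sum (comp_mpoly _)) raddf_sum.
apply: eq_bigr => k _ /=.
by rewrite comp_mpolyZ mcoeffZ rmorphXn /= comp_mpolyXU.
Qed.

Lemma trunc2E d (f : {mfps R[2]}) :
  mfps_trunc d f = \sum_(j < d.+1) \sum_(i < d.+1)
    (if (i + j <= d)%N then f (mon2 i j) else 0) *:
      ('X_(inord 0) ^+ i * 'X_(inord 1) ^+ j).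
Proof.
apply/mpolyP => m.
rewrite mcoeff_trunc raddf_sum /= [in LHS](mon2E m) mdeg_mon2.
under eq_bigr => j _ do (rewrite raddf_sum /=; under eq_bigr => i _ do
  rewrite mcoeffZ !mpolyXn -mpolyXD mcoeffX -/(mon2 i j) eq_sym eq_mon2).
set a := m _; set b := m _; case: ifP => ab.
  have la : (a < d.+1)%N by rewrite ltnS (leq_trans _ ab) ?leq_addr.
  have lb : (b < d.+1)%N by rewrite ltnS (leq_trans _ ab) ?leq_addl.
  rewrite (bigD1 (Ordinal lb)) //= (bigD1 (Ordinal la)) //= ab !eqxx mulr1.
  rewrite !big1 ?addr0 // => [j|i]; rewrite -val_eqE /= => /negPf ne.
    by rewrite big1 // => i _; rewrite (eq_sym b) ne andbF mulr0.
  by rewrite (eq_sym a) ne mulr0.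
rewrite big1 // => j _; rewrite big1 // => i _.
by case: eqP => [<-|]; case: eqP => [<-|]; rewrite ?ab ?mul0r ?mulr0.
Qed.

Lemma mfps_comp2E n (f : {mfps R[2]}) (g h : {mfps R[n]}) m (d := mdeg m) :
  mfps_comp f [tuple g; h] m =
  \sum_(j < d.+1) \sum_(i < d.+1) (if (i + j <= d)%N then f (mon2 i j) else 0) *
      (mfps_trunc d g ^+ i * mfps_trunc d h ^+ j)@_m.
Proof.
rewrite /= trunc2E (raddf_sum (comp_mpoly _)) raddf_sum.
apply: eq_bigr => j _ /=.
rewrite (raddf_sum (comp_mpoly _)) raddf_sum; apply: eq_bigr => i _ /=.
rewrite comp_mpolyZ mcoeffZ rmorphM !rmorphXn /= !comp_mpolyXU.
by rewrite !inordK.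
Qed.

Lemma mcoeff_mfpsX n (i : 'I_n) m : mfpsX R i m = (m == U_(i)%MM)%:R.
Proof. by rewrite /= mcoeffX eq_sym. Qed.

(** The bound is a successor because truncation at degree 0 kills the variable. *)
Lemma mfps_truncX n (i : 'I_n) d : mfps_trunc d.+1 (mfpsX R i) = 'X_i.
Proof.
apply/mpolyP => m; rewrite mcoeff_trunc mcoeff_mfpsX mcoeffX (eq_sym U_(i)%MM).
by case: eqP => [->|]; rewrite ?mdeg1 ?if_same.
Qed.

Lemma mfps_compX n (f : {mfps R[1]}) (i : 'I_n) m :
  mfps_comp f [tuple mfpsX R i] m =
  if m == (U_(i) *+ mdeg m)%MM then f (mon1 (mdeg m)) else 0.
Proof.
rewrite mfps_comp1E; case E: (mdeg m) => [|d].
  move/eqP: E; rewrite mdeg_eq0 => /eqP->.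
  by rewrite big_ord1 expr0 mcoeff1 eqxx mulr1.
rewrite mfps_truncX big_ord_recr /= big1 ?add0r => [|k _].
  by rewrite mpolyXn mcoeffX eq_sym; case: eqP; rewrite (mulr1, mulr0).
rewrite mpolyXn mcoeffX; case: eqP; rewrite ?mulr0 // => mE.
have := congr1 mdeg mE; rewrite mdegMn mdeg1 mul1n E => kE.
by have := ltn_ord k; rewrite kE ltnn.
Qed.

Lemma coef_exp_eq N (p q : {poly R}) k :
    (forall n, (n <= N)%N -> p`_n = q`_n) ->
  forall n, (n <= N)%N -> (p ^+ k)`_n = (q ^+ k)`_n.
Proof.
move=> pq; elim: k => [//|k IH] n le_nN; rewrite !exprS !coefM.
apply: eq_bigr => -[i /=]; rewrite ltnS => le_in _.
by rewrite pq ?IH // (leq_trans _ le_nN) // leq_subr.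
Qed.

Lemma coef_exp_low (p : {poly R}) k n :
  p`_0 = 0 -> (n < k)%N -> (p ^+ k)`_n = 0.
Proof.
move=> p0; elim: k n => [//|k IH] n; rewrite ltnS => le_nk.
rewrite exprS coefM big_ord_recl p0 mul0r add0r big1 // => i _.
rewrite IH ?mulr0 // lift0 (leq_trans _ le_nk) // ltn_subrL //.
by rewrite (leq_ltn_trans _ (ltn_ord i)).
Qed.

Lemma coef1_exp (p : {poly R}) k : p`_0 = 0 -> (p ^+ k)`_1 = p`_1 *+ (k == 1)%N.
Proof.
case: k => [|[|k]] p0; rewrite ?expr0 ?coef1 ?expr1 //.
by rewrite coef_exp_low.
Qed.

(** It keeps N coefficients, so [series_poly d.+1] corresponds to [mfps_trunc d]. *)
Definition series_poly N (f : {mfps R[1]}) := \poly_(k < N) f (mon1 k).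

Lemma bipoly_trunc_compX0 d (f : {mfps R[1]}) :
  bipoly (mfps_trunc d (mfps_comp f [tuple mfpsX R (inord 0)])) =
  (series_poly d.+1 f)%:P.
Proof.
apply/polyP => j; apply/polyP => i; rewrite coef_bipoly mcoeff_trunc mfps_compX.
rewrite mdeg_mon2 eq_sym eq_mon2 !mulmnE !mnm1E eqxx inord01 coefC mul1n.
case: j => [|j]; rewrite ?addn0 ?eqxx /= ?coef0 ?if_same ?coef_poly ?ltnS //.
by rewrite mul0n andbF if_same.
Qed.

Lemma bipoly_trunc_compX1 d (f : {mfps R[1]}) :
  bipoly (mfps_trunc d (mfps_comp f [tuple mfpsX R (inord 1)])) =
  map_poly polyC (series_poly d.+1 f).
Proof.
apply/polyP => j; apply/polyP => i; rewrite coef_bipoly mcoeff_trunc mfps_compX.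
rewrite mdeg_mon2 eq_sym eq_mon2 !mulmnE !mnm1E eqxx coef_map coefC.
rewrite (eq_sym (inord 1)) inord01 mul1n.
case: i => [|i]; rewrite ?add0n ?eqxx /= ?coef0 ?if_same ?coef_poly ?ltnS //.
Qed.

Lemma coef1_exp_XaddC (c : R) k : ((c%:P + 'X) ^+ k)`_1 = c ^+ k.-1 *+ k.
Proof.
have -> (q : {poly R}) : q`_1 = q^`().[0] :> R.
  by rewrite horner_coef0 coef_deriv.
by rewrite deriv_exp derivD derivC derivX add0r mul1r hornerMn !hornerE.
Qed.
End Coefficients.

(** * The addition formula in degree one in v *)

Section Exponential.
Variable R : comNzRingType.

(** Compare the coefficients of u^n v in F(f(u), f(v)) = f(u + v): the right side contributes f'(u),
    and the left side F_1(f(u)), because f(v) = v + O(v^2). *)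
Lemma exponential_ode (F : {mfps R[2]}) f N n :
  is_exponential F f -> (n < N)%N ->
  (series_poly N.+1 f)^`()`_n =
  ((\poly_(k < N.+1) F (mon2 k 1)) \Po series_poly N.+1 f)`_n.
Proof.
case=> f0 f1 Ff lt_nN.
have m1_1 : mon1 1 = U_(ord0)%MM by rewrite /mon1 mulm1n.
have m1_0 : mon1 0 = 0%MM by rewrite /mon1 mulm0n.
have := congr1 (fun g : {mfps R[2]} => g (mon2 n 1)) Ff.
rewrite mfps_comp2E mfps_comp1E mdeg_mon2 addn1.

set P := series_poly n.+2 f.
have P_0 : P`_0 = 0 by rewrite coef_poly m1_0.
have P_1 : P`_1 = 1 by rewrite coef_poly m1_1.
(* The power f(v)^j has a term in v only for j = 1, with coefficient 1. *)
have lhsE (i j : nat) :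
    (mfps_trunc n.+1 (mfps_comp f [tuple mfpsX R (inord 0)]) ^+ i *
     mfps_trunc n.+1 (mfps_comp f [tuple mfpsX R (inord 1)]) ^+ j)@_(mon2 n 1)
     = (P ^+ i)`_n *+ (j == 1)%N.
  rewrite -coef_bipoly bipolyM !bipolyXn.
  rewrite bipoly_trunc_compX0 bipoly_trunc_compX1.
  rewrite -/P -polyC_exp coefCM -rmorphXn /= coef_map /= coef1_exp // P_1.
  by rewrite polyCMn mulr_natr coefMn.
(* By homogeneity only (u + v)^(n+1) contains u^n v, with coefficient n+1. *)
have rhsE (k : nat) :
    (mfps_trunc n.+1 (mfpsX R (inord 0) + mfpsX R (inord 1)) ^+ k)@_(mon2 n 1) =
    (k == n.+1)%:R *+ k.
  rewrite -coef_bipoly bipolyXn.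
  have -> : bipoly (mfps_trunc n.+1 (mfpsX R (inord 0) + mfpsX R (inord 1))) =
      'X%:P + 'X.
    have -> : mfps_trunc n.+1 (mfpsX R (inord 0) + mfpsX R (inord 1)) =
        'X_(inord 0) + 'X_(inord 1) :> {mpoly R[2]}.
      rewrite -!(mfps_truncX _ _ n); apply/mpolyP => m.
      by rewrite mcoeffD !mcoeff_trunc; case: ifP; rewrite ?addr0.
    by rewrite /bipoly rmorphD /= !mmapX !mmap1U eqxx eq_sym inord01.
  rewrite coef1_exp_XaddC coefMn coefXn.
  by case: k => [|k]; rewrite ?mulr0n //= eqSS eq_sym.
under eq_bigr => j _ do under eq_bigr => i _ do rewrite lhsE.
under [X in _ = X -> _]eq_bigr => k _ do rewrite rhsE.
rewrite [X in _ = X -> _]big_ord_recr /=.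
rewrite [X in _ = X + _ -> _]big1 => [|k _]; last first.
  by rewrite ltn_eqF // mul0rn mulr0.
rewrite eqxx add0r mulr_natr.
rewrite big_ord_recl big1 ?add0r => [|i _]; last by rewrite mulr0.
rewrite big_ord_recl [X in _ + X]big1 ?addr0 => [|j _]; last first.
  by rewrite big1 // => i _; rewrite mulr0.
(* For j = 1 the term i = n+1 has total degree n+2 and is cut off by the truncation of F. *)
rewrite big_ord_recr /= addn1 ltnn mul0r addr0 => E.
rewrite coef_deriv coef_poly ltnS lt_nN -E poly_def raddf_sum coef_sum /=.
(* The two sums have different lengths, but f^i vanishes in degree n for i > n, and the two
   truncations of f agree up to degree n. *)
rewrite (big_ord_widen N.+1 (fun i =>
  (if (i + 1 <= n.+1)%N then F (mon2 i 1) else 0) * (P ^+ i)`_n)) 1?ltnW //.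
rewrite big_mkcond; apply: eq_bigr => i _.
rewrite comp_polyZ rmorphXn /= comp_polyX coefZ addn1 ltnS.
case: leqP => [le_in|lt_ni].
  congr (_ * _).
  apply: (@coef_exp_eq _ n) => // k le_kn.
  by rewrite !coef_poly ltnS leqW // ltnS ltnW // (leq_ltn_trans le_kn).
rewrite coef_exp_low ?mulr0 // ?coef_poly ?m1_0 //.
Qed.
End Exponential.

(** * The Buchstaber formal group law modulo v^2 *)

Section Slices.
Variable R : comNzRingType.
Implicit Types f g : {mfps R[2]}.

(** The coefficient of v^j as a series in u; in one variable [mdeg m] is the exponent itself. *)
Definition slice j f : {mfps R[1]} := MFPS (fun m => f (mon2 (mdeg m) j)).

Lemma mfps1P (f g : {mfps R[1]}) : (forall i, f (mon1 i) = g (mon1 i)) -> f = g.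
Proof. by move=> fg; apply: mfpsP => m; rewrite (mon1E m). Qed.

Lemma sliceE j f i : slice j f (mon1 i) = f (mon2 i j).
Proof. by rewrite /= mdeg_mon1. Qed.

Lemma sliceD j f g : slice j (f + g) = slice j f + slice j g.
Proof. by []. Qed.

Lemma sliceB j f g : slice j (f - g) = slice j f - slice j g.
Proof. by []. Qed.

Lemma slice0M f g : slice 0 (f * g) = slice 0 f * slice 0 g.
Proof.
apply: mfps1P => i; rewrite sliceE mfps_mul2E mfps_mul1E big_ord1.
by apply: eq_bigr => a _; rewrite !sliceE.
Qed.

(** Modulo v^2, [slice 1] is a derivation over the multiplicative map [slice 0], so an identity in u
    and v yields two identities in u. *)
Lemma slice1M f g :
  slice 1 (f * g) = slice 0 f * slice 1 g + slice 1 f * slice 0 g.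
Proof.
apply: mfps1P => i; rewrite sliceE mfps_mul2E big_ord_recl big_ord1.
rewrite [RHS](_ : _ = (slice 0 f * slice 1 g) (mon1 i) +
                      (slice 1 f * slice 0 g) (mon1 i)) //.
by rewrite !mfps_mul1E; congr (_ + _); apply: eq_bigr => a _; rewrite !sliceE.
Qed.

Local Notation t := (mfpsX R ord0 : {mfps R[1]}).
Local Notation u := (mfpsX R (inord 0) : {mfps R[2]}).
Local Notation v := (mfpsX R (inord 1) : {mfps R[2]}).

Lemma mfpsC_mon1 (c : R) i : mfpsC 1 c (mon1 i) = if i == 0%N then c else 0.
Proof.
rewrite /= mcoeffC eq_sym -[0%MM](mulm0n U_(ord0)) -/(mon1 0) eq_mon1.
by rewrite mulmnE mnm1E mul1n eq_sym; case: eqP; rewrite (mulr1, mulr0).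
Qed.

Lemma mfpsC1 n : mfpsC n (1 : R) = 1.
Proof. by apply: mfpsP. Qed.

Lemma mfpsC0 n : mfpsC n (0 : R) = 0.
Proof. by apply: mfpsP => m /=; rewrite mcoeffC mul0r. Qed.

Lemma mfpsX_mon1 i : t (mon1 i) = (i == 1)%:R.
Proof.
by rewrite mcoeff_mfpsX -[U_(_)%MM]mulm1n -/(mon1 1) eq_mon1 mulmnE mnm1E mul1n.
Qed.

Lemma eq_mon2_U0 i j : (mon2 i j == U_(inord 0)%MM) = (i == 1)%N && (j == 0)%N.
Proof.
have -> : U_(inord 0)%MM = mon2 1 0.
  by apply/mnmP => k; rewrite mnmDE !mulmnE muln1 muln0 addn0.
by rewrite eq_mon2 mon2_0 mon2_1.
Qed.

Lemma eq_mon2_U1 i j : (mon2 i j == U_(inord 1)%MM) = (i == 0)%N && (j == 1)%N.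
Proof.
have -> : U_(inord 1)%MM = mon2 0 1.
  by apply/mnmP => k; rewrite mnmDE !mulmnE muln1 muln0.
by rewrite eq_mon2 mon2_0 mon2_1.
Qed.

Lemma slice0_u : slice 0 u = t.
Proof.
by apply: mfps1P => i; rewrite sliceE mcoeff_mfpsX eq_mon2_U0 andbT mfpsX_mon1.
Qed.

Lemma slice1_u : slice 1 u = 0.
Proof. by apply: mfps1P => i; rewrite sliceE mcoeff_mfpsX eq_mon2_U0 andbF. Qed.

Lemma slice0_v : slice 0 v = 0.
Proof. by apply: mfps1P => i; rewrite sliceE mcoeff_mfpsX eq_mon2_U1 andbF. Qed.

Lemma slice1_v : slice 1 v = 1.
Proof.
apply: mfps1P => i; rewrite sliceE mcoeff_mfpsX eq_mon2_U1 andbT.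
by rewrite -mfpsC1 mfpsC_mon1; case: (i == _).
Qed.

Lemma slice0_comp_u s : slice 0 (mfps_comp s [tuple u]) = s.
Proof.
apply: mfps1P => i; rewrite sliceE mfps_compX mdeg_mon2 addn0.
by rewrite eq_sym eq_mon2 !mulmnE !mnm1E eqxx inord01 mul1n mul0n !eqxx.
Qed.

Lemma slice_comp_v s j : slice j (mfps_comp s [tuple v]) = mfpsC 1 (s (mon1 j)).
Proof.
apply: mfps1P => i; rewrite sliceE mfps_compX mdeg_mon2 mfpsC_mon1.
rewrite eq_sym eq_mon2 !mulmnE !mnm1E eqxx (eq_sym (inord 1)).
rewrite inord01 mul1n mul0n.
by case: i => [|i] /=; rewrite ?eqxx //.
Qed.

Lemma mfps_of_mpolyM n : {morph @mfps_of_mpoly R n : p q / p * q}.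
Proof.
move=> p q; apply: mfpsP => m /=.
by apply: mcoeffM_congr => k le_km; rewrite mcoeff_trunc le_km.
Qed.

Lemma mfpsCXn (c : R) k i :
  (mfpsC 1 c * t ^+ k) (mon1 i) = c *+ (i == k).
Proof.
have tX : t ^+ k = mfps_of_mpoly ('X_ord0 ^+ k).
  elim: k => [//|k IH].
  by rewrite !exprS mfps_of_mpolyM IH.
rewrite tX -mfps_of_mpolyM /= mcoeffCM mpolyXn mcoeffX eq_sym -/(mon1 i).
by rewrite eq_mon1 mulmnE mnm1E mul1n mulr_natr.
Qed.

Lemma elliptic_mon1 (a1 a2 a3 : R) i :
  (1 - mfpsC 1 a1 * t ^+ 2 + mfpsC 1 a2 * t ^+ 4 - mfpsC 1 a3 * t ^+ 6)
    (mon1 i) = (elliptic_poly a1 a2 a3)`_i.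
Proof.
rewrite /elliptic_poly !(coefD, coefN, coefZ) !coefXn coef1 !mulr_natr.
have split4 (f g h k : {mfps R[1]}) m a b c d :
    f m = a -> g m = b -> h m = c -> k m = d ->
  (f - g + h - k) m = a - b + c - d by move=> <- <- <- <-.
have one1 : (1 : {mfps R[1]}) (mon1 i) = (i == 0)%:R.
  by rewrite -mfpsC1 mfpsC_mon1; case: (i == 0)%N.
apply: split4; [exact: one1 | exact: mfpsCXn ..].
Qed.

Lemma coef_series_polyM N (f g : {mfps R[1]}) n : (n < N)%N ->
  (series_poly N f * series_poly N g)`_n = (f * g) (mon1 n).
Proof.
move=> lt_nN; rewrite coefM mfps_mul1E; apply: eq_bigr => i _.
rewrite !coef_poly (leq_ltn_trans (leq_subr _ _) lt_nN).
by rewrite (leq_trans (ltn_ord i)).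
Qed.

End Slices.

(* The coefficients of v^0 and v^1 in the cleared equation for F, in the form
   in which slicing products leaves them. *)
Lemma slice0_eq (D : idomainType) (t f x : D) : t != 0 ->
  t ^+ 2 * t ^+ 2 = f * f * (t * t + 0 * x) -> f * f = t * t.
Proof.
move=> t0; rewrite mul0r addr0 -!expr2 => E.
by apply: (mulIf (expf_neq0 2 t0)); rewrite -E.
Qed.

Lemma slice1_eq (D : idomainType) (t f s x y z : D) : (2 : D) != 0 -> t != 0 ->
    t ^+ 2 * 0 + 0 * t ^+ 2 = t * t * (t * - s + - s * t + (0 * x + 0 * y)) +
      (t * f + f * t) * (t * t + 0 * z) ->
  f = s.
Proof.
(* After simplification [E] reads 0 = 2 t^3 (f - s). *)
move=> two0 t0 E; have : (s - f) * (t ^+ 3 * 2) = 0.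
  by move/eqP: E; rewrite -subr_eq0 => /eqP <-; ring.
move/eqP; rewrite mulf_eq0 subr_eq0 => /orP[/eqP->//|].
by rewrite mulf_eq0 expf_eq0 (negPf t0) (negPf two0).
Qed.

Lemma inv_sq_clear_denom (K : fieldType) (f a b c : K) : f != 0 -> b != 0 ->
  f ^- 2 = (a / b) ^+ 2 + c -> b ^+ 2 = f ^+ 2 * (a ^+ 2 + c * b ^+ 2).
Proof.
move=> nzf nzb E; have -> : c = f ^- 2 - (a / b) ^+ 2 by rewrite E addrC addKr.
by field; rewrite nzf nzb.
Qed.

(** Brings the defining formula from the fraction field back to the power series, where slices make
    sense. *)
Lemma sq_clear_denom (D : idomainType) (F A B C : D) : F != 0 -> B != 0 ->
    tofrac F ^- 2 = (tofrac A / tofrac B) ^+ 2 + tofrac C ->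
  B ^+ 2 = F ^+ 2 * (A ^+ 2 + C * B ^+ 2).
Proof.
move=> nzF nzB E; apply/eqP; rewrite -tofrac_eq; apply/eqP.
rewrite (tofracXn 2) (tofracM (F ^+ 2)) (tofracD (A ^+ 2)) (tofracM C).
rewrite !(tofracXn 2).
by apply: inv_sq_clear_denom; rewrite ?tofrac_eq0.
Qed.

Section Buchstaber.
Variable R : idomainType.
Hypothesis two_neq0 : (2 : R) != 0.

(** Modulo v^2, u s(v) - v s(u) is u - s(u) v, u^2 - v^2 is u^2, and the a_3 term is 0. The cleared
    equation gives F_0 = u at v^0, up to a sign, and then F_1 = s at v^1. *)
Lemma buchstaber_slice1 (a1 a2 a3 : R) (F : {mfps R[2]}) :
    is_buchstaber_fgl a1 a2 a3 F ->
  let t := mfpsX R ord0 in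
  slice 1 F ^+ 2 =
    1 - mfpsC 1 a1 * t ^+ 2 + mfpsC 1 a2 * t ^+ 4 - mfpsC 1 a3 * t ^+ 6.
Proof.
case=> F00 F10 F01 [s [s0 s2 EF]] t; rewrite -s2.
have two1 : (2 : {mfps R[1]}) != 0.
  apply: contra_neq two_neq0 => /(congr1 (fun f : {mfps R[1]} => f 0%MM)) /=.
  by rewrite !mcoeff1 eqxx.
have t0 : t != 0.
  apply/eqP => /(congr1 (fun f : {mfps R[1]} => f (mon1 1))).
  by rewrite mfpsX_mon1 => /eqP; rewrite oner_eq0.
have s0' : s (mon1 0) = 1 by rewrite /mon1 mulm0n.
(* The coefficient of t in s^2 is 2 s_1, and Q has no linear term. *)
have s1 : s (mon1 1) = 0.
  have := congr1 (fun f : {mfps R[1]} => f (mon1 1)) s2.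
  rewrite elliptic_mon1 expr2 mfps_mul1E big_ord_recl big_ord1 /=.
  rewrite s0' mul1r mulr1.
  rewrite /elliptic_poly !(coefD, coefN, coefZ) !coefXn coef1.
  rewrite !mulr0 !subr0 addr0 -mulr2n => E.
  have /eqP : s (mon1 1) * 2 = 0 by rewrite mulr_natr E.
  by rewrite mulf_eq0 (negPf two_neq0) orbF => /eqP.
have nzF : F != 0.
  apply/eqP => F0; move/eqP: F10; rewrite F0 /= eq_sym; exact/negP/oner_neq0.
have F0U : slice 0 F (mon1 1) = 1 by rewrite sliceE /mon2 mulm1n mulm0n addm0.
(* The monomials u and v are generalised because comparing them by conversion
   does not terminate in practice. *)
move: EF (slice0_u R) (slice1_u R) (slice0_v R) (slice1_v R).
move: (slice0_comp_u s) (slice_comp_v s 0) (slice_comp_v s 1).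
rewrite s0' s1 mfpsC1 mfpsC0.
move: (mfps_comp s _) (mfps_comp s _) => su sv su0 sv0 sv1.
move: (mfpsX R (inord 0)) (mfpsX R (inord 1)) => u v EF u0 u1 v0 v1.
move: EF; set A := _ - _; set B := _ - _ => EF.
have B0 : slice 0 B = t ^+ 2.
  by rewrite sliceB !expr2 !slice0M u0 v0 mul0r subr0.
have nzB : B != 0.
  by apply/eqP => E; move/eqP: B0; rewrite E eq_sym expf_eq0 (negPf t0).
have E := sq_clear_denom nzF nzB EF.
have A0 : slice 0 A = t.
  by rewrite sliceB !slice0M u0 v0 sv0 mul0r subr0 mulr1.
have A1 : slice 1 A = - s.
  rewrite sliceB !slice1M u0 u1 v0 v1 sv1 su0.
  by rewrite !mul0r mulr0 mul1r !add0r.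
have vv0 : slice 0 (v ^+ 2) = 0 by rewrite expr2 slice0M v0 mul0r.
have vv1 : slice 1 (v ^+ 2) = 0 by rewrite expr2 slice1M v0 mul0r mulr0 addr0.
have B1 : slice 1 B = 0.
  by rewrite sliceB vv1 expr2 slice1M u1 mul0r mulr0 addr0 subr0.
have C0 : slice 0 (mfpsC 2 a3 * u ^+ 2 * v ^+ 2) = 0.
  by rewrite slice0M vv0 mulr0.
have C1 : slice 1 (mfpsC 2 a3 * u ^+ 2 * v ^+ 2) = 0.
  by rewrite slice1M vv0 vv1 !mulr0 addr0.
clearbody A B; move: (mfpsC 2 a3 * u ^+ 2 * v ^+ 2) E C0 C1 => C E C0 C1.
have E0 := congr1 (slice 0) E; have E1 := congr1 (slice 1) E.
have eF0 : slice 0 F = t.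
  have : (slice 0 F) ^+ 2 = t ^+ 2.
    rewrite !expr2; apply: (@slice0_eq _ _ _ (t ^+ 2 * t ^+ 2)) => //.
    by move: E0; rewrite !expr2 !(slice0M, sliceD) C0 B0 A0.
  (* The root -u is excluded because the coefficient of u in F is 1 and 2 is nonzero. *)
  move/eqP; rewrite eqf_sqr => /orP[/eqP //|/eqP FN].
  move/eqP: F0U; rewrite FN [_ (mon1 1)](_ : _ = - t (mon1 1)) //.
  rewrite mfpsX_mon1 eqxx.
  by rewrite -subr_eq0 -opprD oppr_eq0 (negPf two_neq0).
move: E1; rewrite !expr2 !(slice0M, slice1M, sliceD) C0 C1 B0 B1 A0 A1 eF0.
by move=> /(slice1_eq two1 t0) ->.
Qed.

End Buchstaber.

(** * Integrality *)

Section Extension.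
Lemma rat_alg_mulrnI (V : lmodType rat) (d : nat) (x y : V) : (0 < d)%N ->
  x *+ d = y *+ d -> x = y.
Proof.
move=> d0; rewrite -!scaler_nat => /(congr1 (fun z => (d%:R^-1 : rat) *: z)).
by rewrite !scalerA mulVf ?scale1r // Num.Theory.pnatr_eq0 -lt0n.
Qed.

Variables (L : comNzRingType) (K B : comAlgType rat).
Variables (iota : {rmorphism L -> K}) (g : {rmorphism L -> B}).

(** Universal property of L tensor Q: an x with d x = iota(y) must go to g(y)/d. *)
Lemma rationalisation_extension : is_rationalisation iota ->
  exists phi : {rmorphism K -> B}, forall y, phi (iota y) = g y.
Proof.
case=> iotaI frac.
pose denom x := projT1 (cid (frac x)).
pose num x := projT1 (cid (projT2 (cid (frac x)))).
have numP x : (0 < denom x)%N /\ x *+ denom x = iota (num x).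
  exact: projT2 (cid (projT2 (cid (frac x)))).
pose phi x : B := ((denom x)%:R^-1 : rat) *: g (num x).
(* Injectivity of [iota] makes the value independent of the chosen fraction; additivity and
   multiplicativity then follow by picking common denominators. *)
have phiP x d y : (0 < d)%N -> x *+ d = iota y -> phi x *+ d = g y.
  move=> d0 xd; have [n0 xn] := numP x.
  have phin : phi x *+ denom x = g (num x).
    by rewrite -scaler_nat scalerA mulfV ?scale1r // Num.Theory.pnatr_eq0 -lt0n.
  apply: (rat_alg_mulrnI n0); rewrite mulrnAC phin -!rmorphMn; congr (g _).
  by apply: iotaI; rewrite !rmorphMn -xd -xn -!mulrnA mulnC.
have phiB : zmod_morphism phi.
  move=> x y; have [dx0 xd] := numP x; have [dy0 yd] := numP y.
  have d0 : (0 < denom x * denom y)%N by rewrite muln_gt0 dx0.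
  apply: (rat_alg_mulrnI d0).
  rewrite (phiP _ _ (num x *+ denom y - num y *+ denom x)) //.
    rewrite mulrnBl mulrnA (phiP _ _ _ dx0 xd) mulnC mulrnA.
    by rewrite (phiP _ _ _ dy0 yd) rmorphB !rmorphMn.
  by rewrite mulrnBl mulrnA xd mulnC mulrnA yd rmorphB !rmorphMn.
have phiM : monoid_morphism phi.
  split.
    by rewrite -[phi 1]mulr1n (phiP _ 1%N 1) ?rmorph1.
  move=> x y; have [dx0 xd] := numP x; have [dy0 yd] := numP y.
  have d0 : (0 < denom x * denom y)%N by rewrite muln_gt0 dx0.
  apply: (rat_alg_mulrnI d0).
  rewrite (phiP _ _ (num x * num y)) //.
    rewrite rmorphM -(phiP _ _ _ dx0 xd) -(phiP _ _ _ dy0 yd).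
    by rewrite mulrnAl mulrnAr mulrnA mulrnAC.
  by rewrite rmorphM -xd -yd mulrnAl mulrnAr mulrnA mulrnAC.
pose phiA := GRing.isZmodMorphism.Build K B phi phiB.
pose phiMM := GRing.isMonoidMorphism.Build K B phi phiM.
pose Phi : {rmorphism K -> B} := HB.pack phi phiA phiMM.
by exists Phi => y; rewrite -[LHS]mulr1n; apply: phiP.
Qed.
End Extension.

(** * The subring of integral polynomials and the final descent *)

Section IntegralPolynomials.
Variable n : nat.

Definition integral_mpoly : {pred {mpoly rat[n]}} :=
  fun p => `[< exists q : {mpoly int[n]}, p = map_mpoly intr q >].

Lemma integral_mpoly_subring : subring_closed integral_mpoly.
Proof.
split.
- by apply/asboolP; exists 1; rewrite rmorph1.
- move=> _ _ /asboolP[p ->] /asboolP[q ->]; apply/asboolP.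
  by exists (p - q); rewrite rmorphB.
- move=> _ _ /asboolP[p ->] /asboolP[q ->]; apply/asboolP.
  by exists (p * q); rewrite rmorphM.
Qed.

HB.instance Definition _ := GRing.isSubringClosed.Build {mpoly rat[n]}
  integral_mpoly integral_mpoly_subring.

Lemma integral_mpolyX i : 'X_i \in integral_mpoly.
Proof. by apply/asboolP; exists 'X_i; rewrite map_mpolyX. Qed.
End IntegralPolynomials.

Theorem proposition3p4
  (OmegaU : comNzRingType) (FU : {mfps OmegaU[2]}) (hU : universal_fgl FU)
  (Theta : nat -> OmegaU) (hTheta : theta_divisor_classes FU Theta)
  (Bc : {rmorphism OmegaU -> {mpoly Zhalf[3]}})
  (hBc : is_buchstaber_genus FU Bc) :
  forall n : nat, (1 <= n)%N ->
    exists p : {mpoly int[3]}, Bc (Theta n) = map_mpoly (intmul 1) p.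
Proof.
move=> n n1; case: hTheta => K [iota [ratK expK]].
(* The exponential has rational coefficients, so the argument runs in Q[a_1, a_2, a_3], to which
   [phi] extends the genus from K. *)
pose to_rat : {rmorphism {mpoly Zhalf[3]} -> {mpoly rat[3]}} :=
  map_mpoly (val : Zhalf -> rat).
have [phi phiE] := rationalisation_extension (to_rat \o Bc) ratK.
have toX i : to_rat 'X_i = 'X_i by exact: map_mpolyX.
have two0 : (2 : {mpoly Zhalf[3]}) != 0.
  apply/eqP => /(congr1 (fun p : {mpoly Zhalf[3]} => val p@_0%MM)).
  by rewrite mcoeffMn mcoeff1 mcoeff0 eqxx rmorphMn.
have := buchstaber_slice1 two0 hBc => /= F2.
set N := n.+1; set f := theta_series iota Theta in expK.
(* The truncation of f_Bc whose last term, in degree n+1, carries [Theta n]; [q] is the matching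
   truncation of F_1. *)
pose p := map_poly phi (series_poly N.+1 f).
pose q := map_poly phi (\poly_(k < N.+1) mfps_map iota FU (mon2 k 1)).
have p0 : p`_0 = 0.
  by rewrite coef_map coef_poly /= mdeg_mon1 rmorph0.
have p1 : p`_1 = 1.
  by rewrite coef_map coef_poly /= mdeg_mon1 rmorph1.
have qE : q = map_poly to_rat (series_poly N.+1 (slice 1 (mfps_map Bc FU))).
  apply/polyP => k; rewrite !coef_map !coef_poly sliceE /=.
  case: ifP => _; first exact: phiE.
  by rewrite (rmorph0 phi); exact: (esym (rmorph0 to_rat)).
have ode1 k : (k < N)%N -> p^`()`_k = (q \Po p)`_k.
  move=> kN; rewrite deriv_map coef_map /= (exponential_ode expK) //.
  by rewrite -map_comp_poly coef_map.
have q2 k : (k < N)%N -> (q ^+ 2)`_k =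
    (elliptic_poly ('X_(inord 0) : {mpoly rat[3]})
                   'X_(inord 1) 'X_(inord 2))`_k.
  move=> kN; rewrite qE -rmorphXn (coef_map to_rat) expr2.
  rewrite (coef_series_polyM _ _ (leqW kN)) -expr2 F2 elliptic_mon1.
  rewrite -(coef_map to_rat) map_elliptic_poly.
  by rewrite !toX.
have tors (x : {mpoly rat[3]}) : x *+ 2 = 0 -> x = 0.
  by move=> x2; apply: (@rat_alg_mulrnI _ 2); rewrite ?mul0rn.
have ode2 := elliptic_ode tors p0 p1 ode1 q2.
(* As [N.-1] is n, the equation holds below degree n and the Hurwitz condition below n+2, just
   enough to reach n+1. *)
have hp := elliptic_hurwitz (integral_mpolyX _) (integral_mpolyX _)
  (integral_mpolyX _) p0 p1 ode2.
have /asboolP[r] : p`_n.+1 *+ n.+1`! \in @integral_mpoly 3 by apply: hp.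
have -> : p`_n.+1 *+ n.+1`! = to_rat (Bc (Theta n)).
  rewrite coef_map coef_poly ltnSn /= mdeg_mon1 -rmorphMn.
  (* Since n is at least 1, the general case of [theta_series] applies, and its factor 1/(n+1)!
     cancels. *)
  case: n n1 {ode1 q2 ode2 N p q p0 p1 qE hp} => // n _.
  rewrite -scaler_nat scalerA mulfV ?scale1r.
    exact: phiE.
  by rewrite Num.Theory.pnatr_eq0 -lt0n fact_gt0.
(* The identity descends coefficientwise from Q to Z[1/2], which embeds in Q. *)
move=> E; exists r; apply/mpolyP => m.
apply: val_inj; have := congr1 (mcoeff m) E.
rewrite !mcoeff_map_mpoly /= => ->.
by rewrite [RHS](rmorph_int (val : {rmorphism Zhalf -> rat})).
Qed.
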